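(* In the Minkowski spacetime ($a=m=0$), fix $r>0$ and let $x,y$ be functions of $\theta\in[0,\pi]$ solving the system $$\begin{cases} y_\theta=-\dfrac{(\Sigma^2H)_r}{2HR^2}x+\left(\dfrac{\Sigma_\theta}{\Sigma}-\dfrac{H_\theta}{2H}\right)y,\\[2mm] x_\theta=\dfrac{R_\theta}{R}x+\left(\dfrac{(\Sigma^2H)_r}{2H\Sigma^2}-\dfrac{\alpha\beta+xyH_\theta}{2H\ell}\right)y.\end{cases}$$ Suppose the derivatives of $x,y$ with respect to $\theta$ are bounded. Then there is a constant $k$ such that $x=-k\cos\theta$ and $y=kr\sin\theta$.
   Context: For Minkowski spacetime in spherical coordinates, $H=r^2\sin^2\theta$, $R=1$, $\Sigma=r$. Furthermore $\alpha=(x^2\Sigma^2+R^2(y^2+\Sigma^2))^{1/2}$, $\beta=(-H_\theta^2+4H(y^2+\Sigma^2))^{1/2}$, $\ell=y^2+\Sigma^2$; subscripts $r,\theta$ denote partial derivatives. Solutions are continuous on $[0,\pi]$, differentiable on $(0,\pi)$, and satisfy the system on $(0,\pi)$ (its coefficients are singular at $\theta=0,\pi$). *)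

(* Defs.v *)
From Stdlib Require Import Reals.
From Coquelicot Require Import Coquelicot.
Open Scope R_scope.

Definition partial_r (F : R -> R -> R) (r theta : R) : R :=
  Derive (fun s => F s theta) r.

Definition partial_theta (F : R -> R -> R) (r theta : R) : R :=
  Derive (fun t => F r t) theta.

(** The metric coefficients [H], [Rf] (the paper's R) and [Sg] (Sigma) are
    functions of [(r, theta)]; [x], [y] are the values of the unknowns. *)

Definition ell (Sg : R -> R -> R) (r theta y : R) : R :=
  y ^ 2 + Sg r theta ^ 2.

Definition alpha (Rf Sg : R -> R -> R) (r theta x y : R) : R :=
  sqrt (x ^ 2 * Sg r theta ^ 2 + Rf r theta ^ 2 * (y ^ 2 + Sg r theta ^ 2)).

Definition beta (H Sg : R -> R -> R) (r theta y : R) : R :=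
  sqrt (- partial_theta H r theta ^ 2
        + 4 * H r theta * (y ^ 2 + Sg r theta ^ 2)).

Definition rhs_y (H Rf Sg : R -> R -> R) (r theta x y : R) : R :=
  - (partial_r (fun s t => Sg s t ^ 2 * H s t) r theta
       / (2 * H r theta * Rf r theta ^ 2)) * x
  + (partial_theta Sg r theta / Sg r theta
     - partial_theta H r theta / (2 * H r theta)) * y.

Definition rhs_x (H Rf Sg : R -> R -> R) (r theta x y : R) : R :=
  partial_theta Rf r theta / Rf r theta * x
  + (partial_r (fun s t => Sg s t ^ 2 * H s t) r theta
       / (2 * H r theta * Sg r theta ^ 2)
     - (alpha Rf Sg r theta x y * beta H Sg r theta y
        + x * y * partial_theta H r theta)
         / (2 * H r theta * ell Sg r theta y)) * y.

(** Only the restrictions of [x] and [y] to [[0, PI]] matter: continuity at the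
    endpoints is one-sided, and the system is imposed on the open interval,
    where its coefficients are nonsingular. *)
Definition is_solution (H Rf Sg : R -> R -> R) (r : R) (x y : R -> R) : Prop :=
  continuous_on (fun theta => 0 <= theta <= PI) x /\
  continuous_on (fun theta => 0 <= theta <= PI) y /\
  forall theta, 0 < theta < PI ->
    is_derive y theta (rhs_y H Rf Sg r theta (x theta) (y theta)) /\
    is_derive x theta (rhs_x H Rf Sg r theta (x theta) (y theta)).

Definition bounded_derivative (f : R -> R) : Prop :=
  exists M : R, forall theta, 0 < theta < PI -> Rabs (Derive f theta) <= M.

Definition H_Minkowski (r theta : R) : R := r ^ 2 * sin theta ^ 2.
Definition R_Minkowski (r theta : R) : R := 1.
Definition Sigma_Minkowski (r theta : R) : R := r.

(* Main.v *)
(** Write [y = r v]. The system becomes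
      [v' = -2 x - cot θ v],
      [x' = (2 - (sqrt (1+x²+v²) sqrt (sin²θ+v²) + x v cos θ) / (sin θ (1+v²))) v].
    Boundedness of [v'] makes [cot θ v] bounded, so [|v| <= M sin θ] and in
    particular [v 0 = 0]. Put [k = - x 0] and compare with the explicit solution:
    for [d = x + k cos θ] and [e = v - k sin θ], the bound on [v / sin θ] makes
    [d'] Lipschitz in [(d, e)], while [e' = -2 d - cot θ e], where the singular
    term has the good sign near [0]. Hence [d² + e²] satisfies a Grönwall
    inequality on every [(0, b)] with [b < π], and it vanishes at [0]. *)
Require Import Defs.
From Stdlib Require Import Reals Lra Psatz.
From Coquelicot Require Import Coquelicot.
Open Scope R_scope.

(** * Continuous functions on a closed interval and Grönwall's inequality *)

Definition clamp (a b t : R) : R := Rmax a (Rmin b t).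

Lemma clamp_in (a b t : R) : a <= b -> a <= clamp a b t <= b.
Proof.
intros hab; unfold clamp, Rmax, Rmin.
repeat destruct Rle_dec; lra.
Qed.

Lemma clamp_id (a b t : R) : a <= t <= b -> clamp a b t = t.
Proof.
intros ht; unfold clamp, Rmax, Rmin.
repeat destruct Rle_dec; lra.
Qed.

Lemma clamp_contraction (a b s t : R) :
  Rabs (clamp a b s - clamp a b t) <= Rabs (s - t).
Proof.
unfold clamp, Rmax, Rmin, Rabs.
repeat destruct Rle_dec; repeat destruct Rcase_abs; lra.
Qed.

(** Turns one-sided continuity at the endpoints into continuity at every real: [clamp a b] is
    1-Lipschitz with values in the interval, so it sends neighbourhoods to relative
    neighbourhoods. *)
Lemma continuous_clamp_extension (a b : R) (f : R -> R) :
  a <= b -> continuous_on (fun t => a <= t <= b) f ->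
  forall t, continuous (fun s => f (clamp a b s)) t.
Proof.
intros hab hf t.
apply (filterlim_comp _ _ _ (clamp a b) f _
  (within (fun s => a <= s <= b) (locally (clamp a b t)))).
- intros P [eps hP]; exists eps; intros s hs.
  apply hP.
  + apply Rle_lt_trans with (2 := hs); apply clamp_contraction.
  + now apply clamp_in.
- apply (hf (clamp a b t)); now apply clamp_in.
Qed.

Lemma is_derive_clamp_extension (a b t l : R) (f : R -> R) :
  a < t < b -> is_derive f t l -> is_derive (fun s => f (clamp a b s)) t l.
Proof.
intros ht; apply is_derive_ext_loc.
apply (locally_interval _ t a b); simpl; try lra.
intros s h1 h2; rewrite clamp_id; [reflexivity | lra].
Qed.

Lemma continuous_le_closure (a b : R) (f : R -> R) :
  a < b -> (forall t, continuous f t) -> (forall t, a < t < b -> f t <= 0) ->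
  forall t, a <= t <= b -> f t <= 0.
Proof.
intros hab hf hle t ht.
destruct (Rle_lt_dec (f t) 0) as [h | h]; [exact h | exfalso].
destruct (hf t (fun z => 0 < z)) as [delta hdelta].
{ now apply open_gt. }
assert (hd := cond_pos delta).
(* Moving [t] by [eta] towards the midpoint stays within [delta] of [t] and lands in the open
   interval. *)
set (eta := Rmin (delta / 2) ((b - a) / 4)).
assert (heta : 0 < eta) by (apply Rmin_pos; lra).
assert (h1 : eta <= delta / 2) by apply Rmin_l.
assert (h2 : eta <= (b - a) / 4) by apply Rmin_r.
assert (near : forall s, Rabs (s - t) < delta -> a < s < b -> False).
{ intros s hs hsab; specialize (hdelta s hs); specialize (hle s hsab); lra. }
destruct (Rle_lt_dec t ((a + b) / 2)).
- apply (near (t + eta)); [apply Rabs_def1|]; lra.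
- apply (near (t - eta)); [apply Rabs_def1|]; lra.
Qed.

Lemma continuous_bounded (a b : R) (f : R -> R) :
  a <= b -> (forall t, continuous f t) ->
  exists B, 0 <= B /\ forall t, a <= t <= b -> Rabs (f t) <= B.
Proof.
intros hab hf.
destruct (continuity_ab_maj (fun t => Rabs (f t)) a b hab) as [m [hm _]].
{ intros c _; apply continuity_pt_filterlim.
  apply (continuous_comp f Rabs); [apply hf | apply continuous_Rabs]. }
exists (Rabs (f m)); split; [apply Rabs_pos | exact hm].
Qed.

(** The product [E t * exp (- C * t)] is nonnegative, nonincreasing and starts at 0. *)
Lemma gronwall_zero (a b C : R) (E dE : R -> R) :
  (forall t, continuous E t) -> E a = 0 -> (forall t, 0 <= E t) ->
  (forall t, a < t < b -> is_derive E t (dE t) /\ dE t <= C * E t) ->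
  forall t, a < t < b -> E t = 0.
Proof.
intros hc ha hpos hE t ht.
(* [MVT_gen] may return an endpoint, where nothing is known about [dE]; hence
   the truncation at [0]. *)
destruct (MVT_gen (fun s => E s * exp (- C * s)) a t
  (fun s => Rmin 0 ((dE s - C * E s) * exp (- C * s)))) as [c [_ hc']].
- rewrite Rmin_left, Rmax_right by lra; intros s hs.
  destruct (hE s) as [hd hle]; [lra |].
  assert (hexp := exp_pos (- C * s)).
  rewrite Rmin_right by nra.
  auto_derive; [now exists (dE s) |].
  change (Derive _ s) with (Derive E s).
  rewrite (is_derive_unique _ _ _ hd); ring.
- intros s _; apply continuity_pt_mult.
  + apply continuity_pt_filterlim, hc.
  + apply continuity_pt_filterlim, (ex_derive_continuous (fun s => exp (- C * s))).
    auto_derive; trivial.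
- rewrite ha in hc'.
  assert (h1 := Rmin_l 0 ((dE c - C * E c) * exp (- C * c))).
  assert (h2 := exp_pos (- C * t)); specialize (hpos t).
  assert (h3 : E t * exp (- C * t) <= 0) by nra.
  nra.
Qed.

(** * Lipschitz estimate for the numerator of the singular term *)

Lemma sqrt_add_sqr_lipschitz (p a b : R) :
  0 <= p -> Rabs (sqrt (p + a ^ 2) - sqrt (p + b ^ 2)) <= Rabs (a - b).
Proof.
intros hp.
(* After squaring, this is [v * (u - v) <= sqrt (p + v ^ 2) * Rabs (u - v)], true because the root
   dominates [Rabs v]. *)
assert (half : forall u v, sqrt (p + u ^ 2) <= sqrt (p + v ^ 2) + Rabs (u - v)).
{ intros u v.
  assert (hv := pow2_ge_0 v).
  assert (h0 := sqrt_pos (p + v ^ 2)).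
  assert (h1 : sqrt (p + v ^ 2) ^ 2 = p + v ^ 2) by (apply pow2_sqrt; lra).
  assert (h2 : Rabs v <= sqrt (p + v ^ 2)).
  { rewrite <- sqrt_Rsqr_abs; apply sqrt_le_1_alt; unfold Rsqr; nra. }
  assert (h3 := Rabs_pos (u - v)).
  assert (h4 := Rle_abs (v * (u - v))); rewrite Rabs_mult in h4.
  assert (h5 := pow2_abs (u - v)).
  rewrite <- (sqrt_pow2 (sqrt (p + v ^ 2) + Rabs (u - v))) by lra.
  apply sqrt_le_1_alt.
  replace ((sqrt (p + v ^ 2) + Rabs (u - v)) ^ 2)
    with (sqrt (p + v ^ 2) ^ 2 + 2 * sqrt (p + v ^ 2) * Rabs (u - v)
          + Rabs (u - v) ^ 2) by ring.
  rewrite h1, h5; nra. }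
assert (hab := half a b); assert (hba := half b a).
rewrite (Rabs_minus_sym b a) in hba.
apply Rabs_le; lra.
Qed.

(** The numerator of [x' - v], up to sign and a factor [v]; it vanishes
    identically on the solution [x = - k c], [v = k s]. *)
Definition defect (s c x v : R) : R :=
  sqrt (1 + x ^ 2 + v ^ 2) * sqrt (s ^ 2 + v ^ 2) + x * v * c - s * (1 + v ^ 2).

(** On the explicit solution the two roots equal [L] and [L * s] with [L = sqrt (1 + k ^ 2)]. In
    general they differ from these values by at most [Rabs d + Rabs e] and [Rabs e], and what
    remains is a polynomial each of whose terms can be given a factor [d] or [e]. *)
Lemma defect_lipschitz (s c x v k X : R) :
  0 <= s -> s ^ 2 + c ^ 2 = 1 -> Rabs x <= X -> Rabs v <= X ->
  Rabs (defect s c x v) <=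
    4 * (1 + X + Rabs k) * (Rabs (x + k * c) + Rabs (v - k * s)).
Proof.
intros hs hsc hx hv.
assert (hs1 : s <= 1) by nra.
assert (hc1 : Rabs c <= 1) by (apply Rabs_le; nra).
set (d := x + k * c); set (e := v - k * s).
set (A := sqrt (1 + x ^ 2 + v ^ 2)); set (B := sqrt (s ^ 2 + v ^ 2)).
set (L := sqrt (1 + k ^ 2)).
assert (hL : L ^ 2 = 1 + k ^ 2) by (apply pow2_sqrt; nra).
assert (hL0 : 0 <= L) by apply sqrt_pos.
assert (hk := Rabs_pos k); assert (hd := Rabs_pos d); assert (he := Rabs_pos e).
assert (hk2 := pow2_abs k).
assert (hLk : L <= 1 + Rabs k) by nra.
assert (hx0 := Rabs_pos x).
assert (hA : Rabs (A - L) <= Rabs d + Rabs e).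
(* Change one variable at a time: first [v] to [k * s], then [x] to [- (k * c)]. *)
{ assert (h1 := sqrt_add_sqr_lipschitz (1 + x ^ 2) v (k * s)).
  assert (h2 := sqrt_add_sqr_lipschitz (1 + (k * s) ^ 2) x (- (k * c))).
  replace (1 + (k * s) ^ 2 + (- (k * c)) ^ 2) with (1 + k ^ 2) in h2
    by (replace (k ^ 2) with (k ^ 2 * (s ^ 2 + c ^ 2)) by (rewrite hsc; ring); ring).
  replace (1 + (k * s) ^ 2 + x ^ 2) with (1 + x ^ 2 + (k * s) ^ 2) in h2 by ring.
  replace (x - - (k * c)) with d in h2 by (unfold d; ring).
  fold A e in h1; fold L in h2.
  specialize (h1 ltac:(nra)); specialize (h2 ltac:(nra)).
  set (Z := sqrt (1 + x ^ 2 + (k * s) ^ 2)) in *.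
  replace (A - L) with ((A - Z) + (Z - L)) by ring.
  apply Rle_trans with (1 := Rabs_triang _ _); lra. }
assert (hB : Rabs (B - L * s) <= Rabs e).
{ assert (h1 := sqrt_add_sqr_lipschitz (s ^ 2) v (k * s)).
  replace (s ^ 2 + (k * s) ^ 2) with ((L * s) ^ 2) in h1
    by (rewrite Rpow_mult_distr, hL; ring).
  rewrite sqrt_pow2 in h1 by nra.
  apply h1; nra. }
assert (hB0 : 0 <= B) by apply sqrt_pos.
assert (hBX : B <= 1 + X).
{ assert (h2 : B ^ 2 = s ^ 2 + v ^ 2) by (apply pow2_sqrt; nra).
  assert (h3 := pow2_abs v); assert (h4 := Rabs_pos v); nra. }
(* The first two terms give [A * B - L ^ 2 * s]. The last two give the rest,
   [x * v * c + s * (k ^ 2 - v ^ 2)], by [s ^ 2 + c ^ 2 = 1]. *)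
replace (defect s c x v)
  with ((A - L) * B + L * (B - L * s) + (v * d - k * c * e) * c
        - s * e * (v + k * s)).
2:{ unfold defect; fold A B; unfold d, e.
    replace ((A - L) * B + L * (B - L * s)) with (A * B - L ^ 2 * s) by ring.
    rewrite hL.
    replace (c * c) with (1 - s ^ 2) by lra.
    assert (hc2 : c ^ 2 = 1 - s ^ 2) by lra.
    ring_simplify. rewrite ?hc2. ring. }
assert (t1 : Rabs ((A - L) * B) <= (Rabs d + Rabs e) * (1 + X)).
{ rewrite Rabs_mult, (Rabs_pos_eq B) by lra.
  apply Rmult_le_compat; auto using Rabs_pos. }
assert (t2 : Rabs (L * (B - L * s)) <= (1 + Rabs k) * Rabs e).
{ rewrite Rabs_mult, (Rabs_pos_eq L) by lra.
  apply Rmult_le_compat; auto using Rabs_pos. }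
assert (hke : Rabs (k * c * e) <= Rabs k * Rabs e).
{ rewrite !Rabs_mult, Rmult_assoc.
  apply Rmult_le_compat_l; [lra |]; nra. }
assert (hvd : Rabs (v * d) <= X * Rabs d).
{ rewrite Rabs_mult; apply Rmult_le_compat_r; lra. }
assert (t3 : Rabs ((v * d - k * c * e) * c) <= X * Rabs d + Rabs k * Rabs e).
{ rewrite Rabs_mult.
  assert (h := Rabs_triang (v * d) (- (k * c * e))); rewrite Rabs_Ropp in h.
  fold (v * d - k * c * e) in h.
  assert (h' := Rabs_pos (v * d - k * c * e)).
  assert (h'' := Rabs_pos c); unfold Rminus in *; nra. }
assert (t4 : Rabs (s * e * (v + k * s)) <= Rabs e * (X + Rabs k)).
{ rewrite !Rabs_mult, (Rabs_pos_eq s) by lra.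
  assert (h := Rabs_triang v (k * s)); rewrite Rabs_mult, (Rabs_pos_eq s) in h by lra.
  apply Rmult_le_compat; try nra; try apply Rabs_pos. }
assert (hX : 0 <= X) by lra.
clear - t1 t2 t3 t4 hk hd he hX.
set (p := (A - L) * B) in *; set (q := L * (B - L * s)) in *.
set (u := (v * d - k * c * e) * c) in *; set (w := s * e * (v + k * s)) in *.
assert (h1 := Rabs_triang (p + q + u) (- w)); rewrite Rabs_Ropp in h1.
assert (h2 := Rabs_triang (p + q) u); assert (h3 := Rabs_triang p q).
replace (p + q + u - w) with (p + q + u + - w) by ring.
assert (0 <= X * Rabs d) by nra; assert (0 <= X * Rabs e) by nra.
assert (0 <= Rabs k * Rabs d) by nra; assert (0 <= Rabs k * Rabs e) by nra.
lra.
Qed.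

(** * Control of the cotangent terms and the energy estimate *)

Lemma opp_cot_bounded (b : R) :
  PI / 2 < b < PI ->
  exists K, 0 <= K /\ forall t, 0 < t < b -> - (cos t / sin t) <= K.
Proof.
intros hb.
assert (hsb : 0 < sin b) by (apply sin_gt_0; lra).
(* Up to [PI / 2] the quantity is nonpositive; beyond, [- cos t <= 1] and the sine decreases to
   [sin b]. *)
exists (/ sin b); split; [left; now apply Rinv_0_lt_compat |].
intros t ht.
assert (hst : 0 < sin t) by (apply sin_gt_0; lra).
assert (hi := Rinv_0_lt_compat _ hsb); assert (hi' := Rinv_0_lt_compat _ hst).
destruct (Rle_lt_dec t (PI / 2)).
- assert (0 <= cos t) by (apply cos_ge_0; lra).
  unfold Rdiv; nra.
- assert (/ sin t <= / sin b).
  { apply Rinv_le_contravar; [assumption |]; apply sin_decr_1; lra. }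
  assert (hcos := COS_bound t); unfold Rdiv; nra.
Qed.

(** A bound on the cotangent term forces [v] to vanish at least like [sin t] at both poles. *)
Lemma sin_dominates (t v X M : R) :
  0 < t < PI -> Rabs v <= X -> Rabs (cos t / sin t * v) <= M ->
  Rabs v <= (M + X) * sin t.
Proof.
intros ht hv hM.
assert (hs : 0 < sin t) by (apply sin_gt_0; lra).
assert (hb := SIN_bound t); assert (hc := COS_bound t).
assert (hsc := sin2_cos2 t); unfold Rsqr in hsc.
set (q := cos t / sin t * v) in *.
(* [v = (sin² + cos²) v] *)
assert (hq : v = (sin t * v + cos t * q) * sin t).
{ unfold q; field_simplify; [| lra].
  replace (sin t ^ 2) with (1 - cos t * cos t) by lra; ring. }
rewrite hq at 1; rewrite Rabs_mult, (Rabs_pos_eq (sin t)) by lra.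
apply Rmult_le_compat_r; [lra |].
apply Rle_trans with (1 := Rabs_triang _ _).
rewrite !Rabs_mult, (Rabs_pos_eq (sin t)) by lra.
assert (hc1 : Rabs (cos t) <= 1) by (apply Rabs_le; lra).
assert (h1 := Rabs_pos v); assert (h2 := Rabs_pos q); nra.
Qed.

(** The left side is the derivative of [d ^ 2 + e ^ 2] along the system, with [q] the cotangent and
    [z] the defect term. The cross terms add up to [- 2 * d * e] and cost 1, [- 2 * d * z] costs
    [4 * N * M], and [- 2 * q * e ^ 2] costs [2 * K]. *)
Lemma energy_derivative_bound (d e q z K N M : R) :
  0 <= K -> 0 <= N -> 0 <= M -> - q <= K ->
  Rabs z <= N * (Rabs d + Rabs e) * M ->
  2 * d * (e - z) + 2 * e * (- 2 * d - q * e)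
    <= (1 + 4 * N * M + 2 * K) * (d ^ 2 + e ^ 2).
Proof.
intros hK hN hM hq hz.
assert (hNM : 0 <= N * M) by nra.
assert (hd := Rabs_pos d); assert (he := Rabs_pos e).
assert (hd2 := pow2_abs d); assert (he2 := pow2_abs e).
assert (h1 : - (d * z) <= Rabs d * (N * (Rabs d + Rabs e) * M)).
{ apply Rle_trans with (Rabs (- (d * z))); [apply Rle_abs |].
  rewrite Rabs_Ropp, Rabs_mult; apply Rmult_le_compat_l; lra. }
assert (h2 : Rabs d * Rabs e <= (d ^ 2 + e ^ 2) / 2).
{ assert (h := pow2_ge_0 (Rabs d - Rabs e)); lra. }
assert (h3 : Rabs d * (N * (Rabs d + Rabs e) * M) <= N * M * (2 * (d ^ 2 + e ^ 2))).
{ replace (Rabs d * (N * (Rabs d + Rabs e) * M))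
    with (N * M * (Rabs d ^ 2 + Rabs d * Rabs e)) by ring.
  apply Rmult_le_compat_l; [lra |]; rewrite hd2; nra. }
assert (h4 : - q * e ^ 2 <= K * e ^ 2) by (apply Rmult_le_compat_r; nra).
assert (h5 : 0 <= K * d ^ 2) by nra.
assert (h6 := pow2_ge_0 (d + e)).
lra.
Qed.

(** * Uniqueness for the normalized system *)

Lemma normalized_uniqueness (x v : R -> R) (M : R) :
  (forall t, continuous x t) -> (forall t, continuous v t) ->
  (forall t, 0 < t < PI -> Rabs (v t) <= M * sin t) ->
  (forall t, 0 < t < PI ->
    is_derive v t (- 2 * x t - cos t / sin t * v t) /\
    is_derive x t (v t - defect (sin t) (cos t) (x t) (v t) * v t
                          / (sin t * (1 + v t ^ 2)))) ->
  exists k, forall t, 0 <= t <= PI -> x t = - k * cos t /\ v t = k * sin t.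
Proof.
intros hx hv hM hder.
assert (hpi := PI_RGT_0).
assert (hM0 : 0 <= M).
{ assert (h := hM (PI / 2) ltac:(lra)); rewrite sin_PI2 in h.
  assert (h' := Rabs_pos (v (PI / 2))); lra. }
destruct (continuous_bounded 0 PI x) as [X1 [hX1 hxX]]; [lra | assumption |].
destruct (continuous_bounded 0 PI v) as [X2 [hX2 hvX]]; [lra | assumption |].
assert (hv0 : v 0 = 0).
{ assert (h := continuous_le_closure 0 PI (fun t => Rabs (v t) - M * sin t) hpi).
  assert (h0 : Rabs (v 0) - M * sin 0 <= 0).
  { apply h; [| intros t ht; assert (h1 := hM t ht); lra | lra].
    intros t; apply (continuous_minus (fun t => Rabs (v t))).
    - apply (continuous_comp v Rabs); [apply hv | apply continuous_Rabs].
    - apply @ex_derive_continuous; auto_derive; trivial. }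
  rewrite sin_0, Rmult_0_r, Rminus_0_r in h0.
  assert (h1 := Rabs_pos (v 0)).
  apply Rabs_eq_0; lra. }
(* The value forced by [x = - k * cos t] at 0; together with [v 0 = 0] it makes the energy start at
   0. *)
set (k := - x 0).
set (N := 4 * (1 + (X1 + X2) + Rabs k)).
assert (hN : 0 <= N) by (unfold N; assert (h := Rabs_pos k); lra).
set (E := fun t => (x t + k * cos t) ^ 2 + (v t - k * sin t) ^ 2).
assert (hE : forall t, continuous E t).
{ assert (hxk : forall t, continuous (fun t => x t + k * cos t) t).
  { intros t; apply (continuous_plus x); [apply hx |].
    apply @ex_derive_continuous; auto_derive; trivial. }
  assert (hvk : forall t, continuous (fun t => v t - k * sin t) t).
  { intros t; apply (continuous_minus v); [apply hv |].
    apply @ex_derive_continuous; auto_derive; trivial. }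
  assert (hsq : forall z : R, continuous (fun z => z ^ 2) z).
  { intros z; apply @ex_derive_continuous; auto_derive; trivial. }
  intros t; unfold E.
  apply (continuous_plus (fun t => (x t + k * cos t) ^ 2)).
  - apply (continuous_comp _ (fun z => z ^ 2)); [apply hxk | apply hsq].
  - apply (continuous_comp _ (fun z => z ^ 2)); [apply hvk | apply hsq]. }
assert (hE0 : E 0 = 0).
{ unfold E, k; rewrite hv0, cos_0, sin_0; ring. }
assert (hpos : forall t, 0 <= E t)
  by (intros t; apply Rplus_le_le_0_compat; apply pow2_ge_0).
assert (hzero : forall t, 0 < t < PI -> E t = 0).
{ intros t ht.
  (* The bound on minus the cotangent degenerates at [PI], so Grönwall is applied up to some
     [b < PI] beyond [t]. *)
  set (b := (PI + Rmax t (PI / 2)) / 2).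
  assert (hb : PI / 2 < b < PI /\ t < b).
  { unfold b, Rmax; destruct Rle_dec; lra. }
  destruct hb as [hb htb].
  destruct (opp_cot_bounded b hb) as [K [hK hcot]].
  (* The explicit pair has zero defect, so subtracting it leaves the same linear part in the
     differences and the defect term unchanged. *)
  eapply (gronwall_zero 0 b (1 + 4 * N * M + 2 * K) E
    (fun t => 2 * (x t + k * cos t)
       * ((v t - k * sin t) - defect (sin t) (cos t) (x t) (v t) * v t
                          / (sin t * (1 + v t ^ 2)))
     + 2 * (v t - k * sin t)
       * (- 2 * (x t + k * cos t) - cos t / sin t * (v t - k * sin t))));
    trivial; [| lra].
  clearbody b; clear t ht htb; intros t ht.
  destruct (hder t) as [hdv hdx]; [lra |].
  assert (hs : 0 < sin t) by (apply sin_gt_0; lra).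
  split.
  - unfold E; auto_derive.
    + split; [eexists; exact hdx | split; [eexists; exact hdv | trivial]].
    + change (Derive (fun u : R => v u) t) with (Derive v t).
      change (Derive (fun u : R => x u) t) with (Derive x t).
      rewrite (is_derive_unique _ _ _ hdv), (is_derive_unique _ _ _ hdx).
      assert (hv2 := pow2_ge_0 (v t)); field; lra.
  - apply energy_derivative_bound; trivial; [now apply hcot |].
    assert (hsc := sin2_cos2 t); unfold Rsqr in hsc.
    assert (hxt := hxX t ltac:(lra)); assert (hvt := hvX t ltac:(lra)).
    assert (hQ : Rabs (defect (sin t) (cos t) (x t) (v t))
      <= N * (Rabs (x t + k * cos t) + Rabs (v t - k * sin t)))
      by (apply defect_lipschitz; lra).
    (* Here [Rabs (v t) <= M * sin t] cancels the singular denominator. *)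
    assert (hw : Rabs (v t / (sin t * (1 + v t ^ 2))) <= M).
    { rewrite Rabs_div by nra.
      rewrite (Rabs_pos_eq (sin t * (1 + v t ^ 2))) by nra.
      apply Rle_div_l; [nra |].
      assert (h := hM t ltac:(lra)).
      apply Rle_trans with (1 := h).
      assert (0 <= M * sin t) by nra; nra. }
    unfold Rdiv; rewrite Rmult_assoc, Rabs_mult.
    apply Rmult_le_compat; auto using Rabs_pos. }
exists k; intros t ht.
(* Continuity carries the vanishing of [E] to the endpoints. *)
assert (h : E t <= 0).
{ apply (continuous_le_closure 0 PI); trivial.
  intros u hu; rewrite hzero by assumption; lra. }
unfold E in h.
assert (h1 := pow2_ge_0 (x t + k * cos t)).
assert (h2 := pow2_ge_0 (v t - k * sin t)).
assert (hd : x t + k * cos t = 0) by (apply Rsqr_0_uniq; rewrite Rsqr_pow2; lra).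
assert (he : v t - k * sin t = 0) by (apply Rsqr_0_uniq; rewrite Rsqr_pow2; lra).
lra.
Qed.

(** * Reduction of the Minkowski system by [y = r v] *)

Lemma rhs_y_Minkowski (r t x v : R) :
  0 < r -> 0 < t < PI ->
  rhs_y H_Minkowski R_Minkowski Sigma_Minkowski r t x (r * v)
  = r * (- 2 * x - cos t / sin t * v).
Proof.
intros hr ht.
assert (hs : 0 < sin t) by (apply sin_gt_0; lra).
unfold rhs_y.
replace (partial_r _ r t) with (4 * r ^ 3 * sin t ^ 2).
2:{ symmetry; apply is_derive_unique; unfold Sigma_Minkowski, H_Minkowski.
    auto_derive; [trivial | ring]. }
replace (partial_theta Sigma_Minkowski r t) with 0
  by (symmetry; exact (Derive_const r t)).
replace (partial_theta H_Minkowski r t) with (2 * r ^ 2 * sin t * cos t).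
2:{ symmetry; apply is_derive_unique; unfold H_Minkowski.
    auto_derive; [trivial | ring]. }
unfold H_Minkowski, R_Minkowski, Sigma_Minkowski; field; lra.
Qed.

(** The regular term contributes [2 * v]; one copy of [v] is absorbed into [defect] as its summand
    [- s * (1 + v ^ 2)]. *)
Lemma rhs_x_Minkowski (r t x v : R) :
  0 < r -> 0 < t < PI ->
  rhs_x H_Minkowski R_Minkowski Sigma_Minkowski r t x (r * v)
  = v - defect (sin t) (cos t) x v * v / (sin t * (1 + v ^ 2)).
Proof.
intros hr ht.
assert (hs : 0 < sin t) by (apply sin_gt_0; lra).
assert (hsc := sin2_cos2 t); unfold Rsqr in hsc.
assert (hth : partial_theta H_Minkowski r t = 2 * r ^ 2 * sin t * cos t).
{ apply is_derive_unique; unfold H_Minkowski.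
  auto_derive; [trivial | ring]. }
unfold rhs_x.
replace (partial_r _ r t) with (4 * r ^ 3 * sin t ^ 2).
2:{ symmetry; apply is_derive_unique; unfold Sigma_Minkowski, H_Minkowski.
    auto_derive; [trivial | ring]. }
replace (partial_theta R_Minkowski r t) with 0
  by (symmetry; exact (Derive_const 1 t)).
replace (alpha _ _ r t x (r * v)) with (r * sqrt (1 + x ^ 2 + v ^ 2)).
2:{ unfold alpha, R_Minkowski, Sigma_Minkowski.
    rewrite <- (sqrt_pow2 r) at 1 by lra.
    rewrite <- sqrt_mult by nra; f_equal; ring. }
(* The radicand is [4 * r ^ 4 * sin t ^ 2 * (1 + v ^ 2 - cos t ^ 2)]. *)
replace (beta _ _ r t (r * v))
  with (2 * r ^ 2 * sin t * sqrt (sin t ^ 2 + v ^ 2)).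
2:{ unfold beta; rewrite hth; unfold H_Minkowski, Sigma_Minkowski.
    rewrite <- (sqrt_pow2 (2 * r ^ 2 * sin t)) at 1 by nra.
    rewrite <- sqrt_mult by nra; f_equal.
    replace ((2 * r ^ 2 * sin t * cos t) ^ 2)
      with (4 * r ^ 4 * sin t ^ 2 * (cos t * cos t)) by ring.
    replace (cos t * cos t) with (1 - sin t * sin t) by lra; ring. }
rewrite hth.
unfold ell, defect, H_Minkowski, R_Minkowski, Sigma_Minkowski; field.
assert (0 < r * r) by nra.
repeat split; nra.
Qed.

Theorem corollary4p1 (r : R) (x y : R -> R)
  (hr : 0 < r)
  (hsol : is_solution H_Minkowski R_Minkowski Sigma_Minkowski r x y)
  (hx : bounded_derivative x)
  (hy : bounded_derivative y) :
  exists k : R, forall theta : R, 0 <= theta <= PI ->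
    x theta = - k * cos theta /\ y theta = k * r * sin theta.
Proof.
assert (hpi := PI_RGT_0).
destruct hsol as [cx [cy hder]]; destruct hy as [B hB].
(* Extensions continuous on the whole line; they agree with [x] and [y] on the closed interval. *)
set (xc := fun t => x (clamp 0 PI t)); set (yc := fun t => y (clamp 0 PI t)).
set (vc := fun t => / r * yc t).
assert (hxc : forall t, continuous xc t)
  by (apply continuous_clamp_extension; [lra | exact cx]).
assert (hyc : forall t, continuous yc t)
  by (apply continuous_clamp_extension; [lra | exact cy]).
assert (hvc : forall t, continuous vc t)
  by (intros t; apply (continuous_scal_r (/ r) yc), hyc).
assert (hyv : forall t, 0 <= t <= PI -> y t = r * vc t).
{ intros t ht; unfold vc, yc; rewrite clamp_id by assumption; field; lra. }
assert (hxx : forall t, 0 <= t <= PI -> x t = xc t)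
  by (intros t ht; unfold xc; rewrite clamp_id by assumption; reflexivity).
destruct (continuous_bounded 0 PI xc) as [X [_ hX]]; [lra | assumption |].
destruct (continuous_bounded 0 PI vc) as [V [_ hV]]; [lra | assumption |].
assert (hry : forall t, 0 < t < PI ->
  is_derive y t (r * (- 2 * xc t - cos t / sin t * vc t))).
{ intros t ht; destruct (hder t ht) as [h _].
  rewrite (hyv t), (hxx t), rhs_y_Minkowski in h by lra; exact h. }
(* Since [v'] is bounded by [/ r * B] and [2 * x] by [2 * X], the cotangent term is bounded by their
   sum; [V] is the extra summand from [sin_dominates]. *)
destruct (normalized_uniqueness xc vc (/ r * B + 2 * X + V)) as [k hk]; trivial.
- intros t ht; apply sin_dominates; [assumption | apply hV; lra |].
  assert (hBt := hB t ht); rewrite (is_derive_unique _ _ _ (hry t ht)) in hBt.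
  rewrite Rabs_mult, (Rabs_pos_eq r) in hBt by lra.
  set (q := cos t / sin t * vc t) in *.
  assert (h1 : Rabs (- 2 * xc t - q) <= / r * B).
  { rewrite (Rmult_comm (/ r)); apply Rle_div_r; [assumption |]; lra. }
  assert (h2 := hX t ltac:(lra)).
  apply Rabs_le_between in h1; apply Rabs_le_between in h2.
  apply Rabs_le; lra.
- intros t ht; split.
  + rewrite <- (Rmult_1_l (_ - _)), <- (Rinv_l r), Rmult_assoc by lra.
    apply (is_derive_scal yc); unfold yc.
    now apply is_derive_clamp_extension, hry.
  + rewrite <- rhs_x_Minkowski with (r := r) by assumption.
    rewrite <- hyv, <- hxx by lra.
    now apply is_derive_clamp_extension, hder.
- exists k; intros t ht; destruct (hk t ht) as [h1 h2].
  rewrite (hxx t), (hyv t), h1, h2 by assumption; split; ring.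
Qed.
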